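(* Let $G$ be a finite connected graph, let $X$ be a variance-optimal function over $G$, and let $w_0, w_1, \ldots, w_k$ ($k\ge 1$) be a hair of $G$. Then the sequence of values $X(w_0), X(w_1), \ldots, X(w_k)$ is unimodular. Let $m = \min_{0\le i\le k} X(w_i)$ and $M = \max_{0\le i\le k} X(w_i)$. If $G$ has vertices $u', u''$ such that $X(u') \leq m+1$, $X(u'') \geq M-1$, and $u',u'' \notin \{w_1, \ldots, w_k\}$, then the sequence $X(w_0), X(w_1), \ldots, X(w_k)$ is monotone.
   Context: A function $X:V(G)\to\mathbb{R}$ is Lipschitz if $|X(u)-X(v)|\le d_G(u,v)$ for all vertices $u,v$, where $d_G$ is the graph distance. Such a function is treated as a random variable by placing the uniform distribution on $V(G)$. Let $c^2(G)=\max_X \operatorname{Var}(X)$, the maximum being over Lipschitz functions $X$ on $V(G)$. A function $X$ is variance-optimal if it is Lipschitz and $\operatorname{Var}(X)=c^2(G)$. $N(v)$ is the set of neighbours of $v$. A hair of $G$ is a sequence of vertices $w_0,w_1,\ldots,w_k$ such that $N(w_i)=\{w_{i-1},w_{i+1}\}$ for $1\le i\le k-1$ and $N(w_k)=\{w_{k-1}\}$. The sequence $X(w_0),\ldots,X(w_k)$ is unimodular if there is $0\le \ell\le k$ such that $X(w_i)-X(w_{i-1})=X(w_{i'})-X(w_{i'-1})$ for all $1\le i,i'\le \ell$, and $X(w_j)-X(w_{j-1})=X(w_{j'})-X(w_{j'-1})$ for all $\ell<j,j'\le k$.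
   Formalization: The vertices w_0, ..., w_k of a hair are additionally required to be pairwise distinct; without this, a, b, a, b would be a hair of the one-edge graph, and its values 0, 1, 0, 1 are not unimodular. *)

(* Defs.v *)
From HB Require Import structures.
From mathcomp Require Import all_boot all_order all_algebra.
From mathcomp Require Import boolp classical_sets reals.
Set Implicit Arguments.
Unset Strict Implicit.
Unset Printing Implicit Defensive.
Import Order.TTheory GRing.Theory Num.Theory.
Local Open Scope ring_scope.

(* A finite simple graph is a symmetric irreflexive relation e on T : finType;
   symmetry and irreflexivity are assumed where they are needed. *)

Definition connected_graph (T : finType) (e : rel T) : Prop :=
  forall u v : T, connect e u v.

Definition neighbours (T : finType) (e : rel T) (v : T) : {set T} :=
  [set u | e v u].

Definition has_walk (T : finType) (e : rel T) (u v : T) (n : nat) : bool :=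
  [exists p : n.-tuple T, path e u p && (last u p == v)].

(* The least n < #|T| such that there is a walk of length n from u to v. The
   default value #|T| is taken only if u and v lie in different components. *)
Definition gdist (T : finType) (e : rel T) (u v : T) : nat :=
  find (has_walk e u v) (iota 0 #|T|).

Definition glipschitz (R : realType) (T : finType) (e : rel T) (X : T -> R) :
    Prop :=
  forall u v : T, `|X u - X v| <= (gdist e u v)%:R.

Definition mean (R : realType) (T : finType) (X : T -> R) : R :=
  (\sum_(v : T) X v) / #|T|%:R.

Definition variance (R : realType) (T : finType) (X : T -> R) : R :=
  mean (fun v => (X v - mean X) ^+ 2).

Definition c2 (R : realType) (T : finType) (e : rel T) : R :=
  sup [set variance X | X in [set X : T -> R | glipschitz e X]]%classic.

Definition variance_optimal (R : realType) (T : finType) (e : rel T)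
    (X : T -> R) : Prop :=
  glipschitz e X /\ variance X = c2 R e.

(* Only w 0, ..., w k matter. The vertices of the sequence are required to be
   distinct: otherwise a, b, a, b, ... would be a hair of arbitrary length in
   the one-edge graph with vertices a and b. *)
Definition hair (T : finType) (e : rel T) (k : nat) (w : nat -> T) : Prop :=
  [/\ {in [pred i | (i <= k)%N] &, injective w},
      forall i, (1 <= i < k)%N -> neighbours e (w i) = [set w i.-1; w i.+1]
    & neighbours e (w k) = [set w k.-1]].

Definition unimodular (R : realType) (k : nat) (x : nat -> R) : Prop :=
  exists l : nat, [/\ (l <= k)%N,
    forall i i', (1 <= i <= l)%N -> (1 <= i' <= l)%N ->
      x i - x i.-1 = x i' - x i'.-1
  & forall j j', (l < j <= k)%N -> (l < j' <= k)%N ->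
      x j - x j.-1 = x j' - x j'.-1].

Definition monotone_seq (R : realType) (k : nat) (x : nat -> R) : Prop :=
  (forall i j, (i <= j <= k)%N -> x i <= x j) \/
  (forall i j, (i <= j <= k)%N -> x j <= x i).

(* The set of variances in the definition of c2 is bounded above, so that c2 is
   a genuine supremum, and a maximum as soon as it is attained. *)
Lemma gdist_le (T : finType) (e : rel T) (u v : T) : (gdist e u v <= #|T|)%N.
Proof. by rewrite -[leqRHS](size_iota 0) find_size. Qed.

Lemma variance_glipschitz_le (R : realType) (T : finType) (e : rel T)
  (X : T -> R) : glipschitz e X -> variance X <= #|T|%:R ^+ 2.
Proof.
move=> LX.
have [T0|T0] := posnP #|T|.
  by rewrite /variance /mean T0 invr0 mulr0 exprn_ge0.
have c0 : 0 < #|T|%:R :> R by rewrite ltr0n.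
rewrite /variance {1}/mean ler_pdivrMr //.
have -> : #|T|%:R ^+ 2 * #|T|%:R = \sum_(v : T) #|T|%:R ^+ 2 :> R.
  by rewrite sumr_const mulr_natr.
apply: ler_sum => v _; rewrite -real_normK ?num_real//.
rewrite ler_sqr ?nnegrE ?normr_ge0 ?ler0n //.
have -> : X v - mean X = (\sum_(u : T) (X v - X u)) / #|T|%:R.
  rewrite sumrB sumr_const mulrBl -[X v *+ _]mulr_natr mulfK ?gt_eqF //.
rewrite normrM [`|_^-1|]ger0_norm ?invr_ge0 ?ler0n // ler_pdivrMr //.
apply: le_trans (ler_norm_sum _ _ _) _.
have -> : #|T|%:R * #|T|%:R = \sum_(u : T) #|T|%:R :> R.
  by rewrite sumr_const mulr_natr.
by apply: ler_sum => u _; apply: le_trans (LX v u) _; rewrite ler_nat gdist_le.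
Qed.

Lemma variance_optimalP (R : realType) (T : finType) (e : rel T) (X : T -> R) :
  variance_optimal e X <->
  glipschitz e X /\
  (forall Y : T -> R, glipschitz e Y -> variance Y <= variance X).
Proof.
split=> -[LX hX]; split=> //.
  move=> Y LY; rewrite hX; apply: ub_le_sup; last by exists Y.
  by exists (#|T|%:R ^+ 2) => _ [Z LZ <-]; apply: variance_glipschitz_le LZ.
apply/eqP; rewrite eq_le; apply/andP; split.
  apply: ub_le_sup; last by exists X.
  by exists (#|T|%:R ^+ 2) => _ [Z LZ <-]; apply: variance_glipschitz_le LZ.
apply: ge_sup; first by exists (variance X), X.
by move=> _ [Y LY <-]; apply: hX.
Qed.

(* Main.v *)
(* Write x_i = X (w i), y_i = x_i - mean X, n = #|T|. For connected graphs,
   Lipschitz means that X changes by at most 1 along each edge, so a block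
   w_a, ..., w_(a+s-1) of the hair may be translated by t as soon as the steps
   at its two ends stay in [-1, 1]; optimality then gives
   2 t (y_a + ... + y_(a+s-1)) + t^2 (s - s^2 / n) <= 0.
   - Translating a tail by small t and -t shows that all steps are 1 or -1.
   - Suppose that the steps are +1 at p, -1 on p+1, ..., q and +1 at q+1, and
     let L = q - p and c = k - q. Translating p+1, ..., q by 2 and p, ..., q-1
     by -2 gives n <= 2 L; translating the tail from q+1 by -2 then gives
     L < c. This contradicts L + c + 2 <= n. Up to the symmetry X -> -X, this
     is unimodularity.
   - Suppose that the steps are +1 at l and -1 on the r remaining edges.
     Translating the tails from l+1 and from l gives 3 n <= 4 r + 2. But the
     values outside the hair leave no gap of length 1 between a value
     <= x_k + 1 and a value >= x_l - 1 = x_k + r - 1, so there are at least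
     r - 1 vertices outside the hair and 2 r <= n, a contradiction. *)
Require Import Defs.
From HB Require Import structures.
From mathcomp Require Import all_boot all_order all_algebra.
From mathcomp Require Import boolp classical_sets reals.
From mathcomp Require Import zify ring lra.
Set Implicit Arguments.
Unset Strict Implicit.
Unset Printing Implicit Defensive.
Import Order.TTheory GRing.Theory Num.Theory.
Local Open Scope ring_scope.

(** * Lipschitz functions along edges, and the variance under translation of a set *)

Definition edge_lipschitz (R : realType) (T : finType) (e : rel T)
    (X : T -> R) : Prop :=
  forall u v, e u v -> `|X u - X v| <= 1.

(** Optimality in local form: a modified function has to be checked only on the edges where it
    changes. On connected graphs it agrees with [variance_optimal], by [glipschitzP]. *)
Definition edge_optimal (R : realType) (T : finType) (e : rel T)
    (X : T -> R) : Prop :=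
  edge_lipschitz e X /\
  forall Y : T -> R, edge_lipschitz e Y -> variance Y <= variance X.

Lemma has_walkP (T : finType) (e : rel T) (u v : T) (n : nat) :
  reflect (exists p, [/\ size p = n, path e u p & last u p = v])
          (has_walk e u v n).
Proof.
apply: (iffP existsP) => [[p /andP[up /eqP pv]]|[p [sp up pv]]].
  by exists p; rewrite size_tuple.
have sp' : size p == n by rewrite sp.
by exists (Tuple sp'); rewrite up pv eqxx.
Qed.

Lemma glipschitzP (R : realType) (T : finType) (e : rel T) (X : T -> R) :
  irreflexive e -> connected_graph e ->
  glipschitz e X <-> edge_lipschitz e X.
Proof.
move=> e_irr e_conn; split=> LX u v.
  move=> euv; apply: le_trans (LX u v) _; rewrite (ler_nat R _ 1) /gdist leqNgt.
  apply/negP => lt1.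
  have T1 : (1 < #|T|)%N.
    by apply: leq_trans lt1 _; rewrite -[leqRHS](size_iota 0) find_size.
  have := before_find 0%N lt1; rewrite nth_iota // => /has_walkP[].
  by exists [:: v]; rewrite /= euv.
rewrite /gdist; set d := find _ _.
(* A path with distinct vertices has length below [#|T|], so the search in [gdist] succeeds and [d]
   is the length of an actual walk. *)
have dT : (d < size (iota 0 #|T|))%N.
  have /connectP[p up] := e_conn u v.
  have [p' up' p'_uniq _ ev] := shortenP up.
  rewrite -has_find; apply/hasP; exists (size p').
    rewrite mem_iota /= add0n -[(size p').+1]/(size (u :: p')).
    by rewrite -(card_uniqP p'_uniq) max_card.
  by apply/has_walkP; exists p'.
have := dT; rewrite -has_find => /(nth_find 0%N).
rewrite size_iota in dT; rewrite nth_iota // -/d add0n.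
move=> /has_walkP[p [<- + <-]].
elim: p u {d dT} => [|x p IHp] u /=; first by rewrite subrr normr0.
move=> /andP[eux xp]; rewrite -add1n natrD.
apply: le_trans (ler_distD (X x) _ _) _.
by apply: lerD; [exact: LX | exact: IHp].
Qed.

Lemma varianceE (R : realType) (T : finType) (X : T -> R) :
  (0 < #|T|)%N ->
  variance X * #|T|%:R = \sum_v X v ^+ 2 - (\sum_v X v) ^+ 2 / #|T|%:R.
Proof.
move=> T0; have N0 : #|T|%:R != 0 :> R by rewrite pnatr_eq0 -lt0n.
rewrite /variance {1}/mean divfK //.
under eq_bigr do rewrite sqrrB.
rewrite big_split sumrB /= sumr_const sumrMnl -mulr_suml -mulr_natr /mean.
by field.
Qed.

(** This symmetry exchanges rising and falling steps, so each forbidden pattern is treated in one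
    orientation only. *)
Lemma edge_optimalN (R : realType) (T : finType) (e : rel T) (X : T -> R) :
  edge_optimal e X -> edge_optimal e (fun v => - X v).
Proof.
have LN (Y : T -> R) : edge_lipschitz e Y -> edge_lipschitz e (fun v => - Y v).
  by move=> LY u v /LY; rewrite -opprD normrN.
have VN (Y : T -> R) : variance (fun v => - Y v) = variance Y.
  rewrite /variance /mean sumrN mulNr; congr (_ / _).
  by apply: eq_bigr => v _; rewrite -opprD sqrrN.
case=> LX X_max; split; first exact: LN.
by move=> Y LY; rewrite VN -VN; apply/X_max/LN.
Qed.

(** Exact expansion in [t]; the term in [#|A| ^+ 2] comes from the displacement of the mean by
    [t * #|A| / #|T|]. *)
Lemma variance_shift (R : realType) (T : finType) (X : T -> R) (A : {set T})
    (t : R) :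
  (0 < #|T|)%N ->
  (variance (fun v => X v + (if v \in A then t else 0)) - variance X)
    * #|T|%:R =
  2 * t * (\sum_(v in A) (X v - mean X))
    + t ^+ 2 * (#|A|%:R - #|A|%:R ^+ 2 / #|T|%:R).
Proof.
move=> T0; have N0 : #|T|%:R != 0 :> R by rewrite pnatr_eq0 -lt0n.
have S1 : \sum_v (X v + (if v \in A then t else 0)) =
    \sum_v X v + #|A|%:R * t.
  by rewrite big_split /= -big_mkcond /= sumr_const mulr_natl.
have S2 : \sum_v (X v + (if v \in A then t else 0)) ^+ 2 =
    \sum_v X v ^+ 2 + (2 * t * (\sum_(v in A) X v) + #|A|%:R * t ^+ 2).
  under eq_bigr => v _.
    rewrite (_ : _ ^+ 2 =
      X v ^+ 2 + (if v \in A then 2 * t * X v + t ^+ 2 else 0)); last first.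
      by case: ifP => _; ring.
    over.
  rewrite big_split -big_mkcond big_split /= -mulr_sumr sumr_const.
  by rewrite [#|A|%:R * _]mulr_natl.
rewrite mulrBl !varianceE // S1 S2 sumrB sumr_const -mulr_natl /mean.
by field.
Qed.

Lemma sum_arith (R : realType) (s : nat) (h d : R) :
  \sum_(i < s) (h + d * i%:R) = s%:R * (h + d * (s%:R - 1) / 2).
Proof.
elim: s => [|s IHs]; first by rewrite big_ord0 mul0r.
by rewrite big_ord_recr /= IHs -natr1; field.
Qed.

(** * Hairs and translations of their blocks *)

Lemma hair_card (T : finType) (e : rel T) (k : nat) (w : nat -> T) :
  hair e k w -> (k < #|T|)%N.
Proof.
case=> w_inj _ _; rewrite -[k.+1]card_ord.
apply: (@leq_card _ _ (fun i : 'I_k.+1 => w i)) => i j /w_inj eij.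
by apply/val_inj/eij; rewrite inE -ltnS ltn_ord.
Qed.

Lemma hair_edge (T : finType) (e : rel T) (k : nat) (w : nat -> T) (i : nat) :
  hair e k w -> (1 <= i <= k)%N -> e (w i) (w i.-1).
Proof.
case=> _ w_mid w_end /andP[i1]; rewrite leq_eqVlt => /orP[/eqP->|ik].
  have : w k.-1 \in neighbours e (w k) by rewrite w_end inE.
  by rewrite inE.
have : w i.-1 \in neighbours e (w i) by rewrite w_mid ?i1 // !inE eqxx.
by rewrite inE.
Qed.

Lemma hair_neighbour (T : finType) (e : rel T) (k : nat) (w : nat -> T)
    (i : nat) (v : T) :
  hair e k w -> (1 <= i <= k)%N -> e (w i) v ->
  v = w i.-1 \/ (i < k)%N /\ v = w i.+1.
Proof.
case=> _ w_mid w_end /andP[i1]; rewrite leq_eqVlt => /orP[/eqP->|ik] ev.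
  have : v \in neighbours e (w k) by rewrite inE.
  by rewrite w_end inE => /eqP; left.
have : v \in neighbours e (w i) by rewrite inE.
by rewrite w_mid ?i1 // !inE => /orP[] /eqP; [left | right].
Qed.

(* First-order and second-order terms of the variance when the block
   [w a, ..., w (a + s - 1)] is translated by [t]. *)
Lemma hair_shift (R : realType) (T : finType) (e : rel T) (X : T -> R)
    (k : nat) (w : nat -> T) (a s : nat) (t : R) :
  symmetric e -> edge_optimal e X -> hair e k w ->
  (0 < a)%N -> (0 < s)%N -> (a + s <= k.+1)%N ->
  `|X (w a) - X (w a.-1) + t| <= 1 ->
  ((a + s <= k)%N -> `|X (w (a + s)%N) - X (w (a + s).-1) - t| <= 1) ->
  2 * t * (\sum_(i < s) (X (w (a + i)%N) - mean X))
    + t ^+ 2 * (s%:R - s%:R ^+ 2 / #|T|%:R) <= 0.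
Proof.
move=> e_sym [LX X_max] w_hair a0 s0 ask da db.
have [w_inj _ _] := w_hair.
have T0 : (0 < #|T|)%N by apply: leq_ltn_trans (hair_card w_hair).
pose A := [set w (a + i)%N | i : 'I_s].
have wi_inj : injective (fun i : 'I_s => w (a + i)%N).
  move=> i j /w_inj eij; apply/val_inj/(@addnI a)/eij; rewrite inE;
    have := ltn_ord i; have := ltn_ord j; lia.
have cA : #|A| = s by rewrite card_imset // card_ord.
have sA : \sum_(v in A) (X v - mean X) =
    \sum_(i < s) (X (w (a + i)%N) - mean X).
  by rewrite big_imset //= => i j _ _ /wi_inj.
have memA j : (a <= j < a + s)%N -> w j \in A.
  move=> /andP[aj jas]; have js : (j - a < s)%N by lia.
  by apply/imsetP; exists (Ordinal js); rewrite //= subnKC.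
pose Y v := X v + (if v \in A then t else 0).
(* An edge leaves the block only at its two ends: since [0 < a], the block avoids [w 0], the one
   vertex of the hair that may have neighbours elsewhere. *)
have bdry u v : e u v -> u \in A -> v \notin A -> `|X u + t - X v| <= 1.
  move=> + /imsetP[i _ eu] vA; rewrite eu => euv.
  have si := ltn_ord i.
  have ik : (1 <= a + i <= k)%N by lia.
  have [ev|[lt_k ev]] := hair_neighbour w_hair ik euv.
    have i0 : i = 0%N :> nat.
      apply/eqP; apply: contraNT vA => i0; rewrite ev; apply: memA; lia.
    by move: da; rewrite ev i0 addn0 addrAC.
  have i1 : (a + i).+1 = (a + s)%N.
    apply/eqP; apply: contraNT vA => i0; rewrite ev; apply: memA; lia.
  rewrite ev i1 distrC opprD addrA -[in X (w (a + i)%N)]/((a + i).+1.-1) i1.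
  by apply: db; lia.
have LY : edge_lipschitz e Y.
  move=> u v euv; rewrite /Y; case: ifPn => uA; case: ifPn => vA.
  - by rewrite [X v + t]addrC addrKA LX.
  - by rewrite addr0 bdry.
  - by rewrite addr0 distrC bdry // e_sym.
  - by rewrite !addr0 LX.
rewrite -sA -cA -variance_shift // mulr_le0_ge0 ?ler0n // subr_le0.
exact: X_max.
Qed.

Lemma hair_step (R : realType) (T : finType) (e : rel T) (X : T -> R)
    (k : nat) (w : nat -> T) (i : nat) :
  symmetric e -> edge_optimal e X -> hair e k w -> (1 <= i <= k)%N ->
  X (w i) - X (w i.-1) = 1 \/ X (w i) - X (w i.-1) = -1.
Proof.
move=> e_sym X_opt w_hair ik; have kT := hair_card w_hair.
have := X_opt.1 _ _ (hair_edge w_hair ik).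
set d := X (w i) - _ => d1.
(* The block is the whole tail from [w i], so the step at [i] is the only one that changes. *)
pose s := (k.+1 - i)%N.
have s_lt : (0 < s < #|T|)%N by rewrite /s; lia.
have shift t : `|d + t| <= 1 ->
    2 * t * (\sum_(j < s) (X (w (i + j)%N) - mean X))
      + t ^+ 2 * (s%:R - s%:R ^+ 2 / #|T|%:R) <= 0.
  by move=> dt; apply: hair_shift; eauto; rewrite /s; lia.
have f0 : 0 < s%:R - s%:R ^+ 2 / #|T|%:R :> R.
  have /andP[s0 sT] := s_lt.
  rewrite expr2 -mulrA -{1}[s%:R]mulr1 -mulrBr mulr_gt0 ?ltr0n //.
  by rewrite subr_gt0 ltr_pdivrMr ?mul1r ?ltr_nat // ltr0n; lia.
(* [1 - |d|] is the largest translation admissible in both directions. *)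
have [t [tp tm t0]] : exists t : R, [/\ `|d + t| <= 1, `|d + - t| <= 1
    & t = 0 -> `|d| = 1].
  exists (1 - `|d|); move: d1; case: (ler0P d) => d0 d1.
    by split; rewrite ?ler_norml; lra.
  by split; rewrite ?ler_norml; lra.
have := shift _ tp; have := shift _ tm.
set f := _ - _ / _ in f0 *; set S := \sum_(_ < _) _ => hm hp.
(* The first-order terms for [t] and [-t] cancel in the sum. *)
have : t ^+ 2 * f <= 0 by rewrite sqrrN in hm; lra.
rewrite pmulr_lle0 // => t2.
have /t0 : t = 0 by apply/eqP; rewrite -sqrf_eq0 eq_le t2 sqr_ge0.
by case: ler0P => _; lra.
Qed.

(** Translation by 2 reverses the step -1 at the left end and, if the block stops before [w k], the
    step 1 at the right end. The bound is the optimality inequality divided by 4. *)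
Lemma hair_shift_up (R : realType) (T : finType) (e : rel T) (X : T -> R)
    (k : nat) (w : nat -> T) (a s : nat) :
  symmetric e -> edge_optimal e X -> hair e k w ->
  (0 < a)%N -> (0 < s)%N -> (a + s <= k.+1)%N ->
  X (w a) - X (w a.-1) = -1 ->
  ((a + s <= k)%N -> X (w (a + s)%N) - X (w (a + s).-1) = 1) ->
  \sum_(i < s) (X (w (a + i)%N) - mean X) <= - (s%:R * (1 - s%:R / #|T|%:R)).
Proof.
move=> e_sym X_opt w_hair a0 s0 ask da db.
have := @hair_shift _ _ _ _ _ _ a s 2 e_sym X_opt w_hair a0 s0 ask.
rewrite da => hs.
suff : 2 * 2 * (\sum_(i < s) (X (w (a + i)%N) - mean X))
    + 2 ^+ 2 * (s%:R - s%:R ^+ 2 / #|T|%:R) <= 0 by lra.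
by apply: hs => [|/db->]; rewrite ler_norml; lra.
Qed.

Lemma hair_shift_down (R : realType) (T : finType) (e : rel T) (X : T -> R)
    (k : nat) (w : nat -> T) (a s : nat) :
  symmetric e -> edge_optimal e X -> hair e k w ->
  (0 < a)%N -> (0 < s)%N -> (a + s <= k.+1)%N ->
  X (w a) - X (w a.-1) = 1 ->
  ((a + s <= k)%N -> X (w (a + s)%N) - X (w (a + s).-1) = -1) ->
  s%:R * (1 - s%:R / #|T|%:R) <= \sum_(i < s) (X (w (a + i)%N) - mean X).
Proof.
move=> e_sym X_opt w_hair a0 s0 ask da db.
have := @hair_shift _ _ _ _ _ _ a s (-2) e_sym X_opt w_hair a0 s0 ask.
rewrite da => hs.
suff : 2 * (-2) * (\sum_(i < s) (X (w (a + i)%N) - mean X))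
    + (-2) ^+ 2 * (s%:R - s%:R ^+ 2 / #|T|%:R) <= 0 by lra.
by apply: hs => [|/db->]; rewrite ler_norml; lra.
Qed.

(** * Unimodularity: exclusion of two changes of direction *)

Lemma descent (R : realType) (x : nat -> R) (p L : nat) :
  (forall i, (p < i <= p + L)%N -> x i - x i.-1 = -1) ->
  forall j, (j <= L)%N -> x (p + j)%N = x p - j%:R.
Proof.
move=> dx; elim=> [|j IHj] jL; first by rewrite addn0 subr0.
have := dx (p + j.+1)%N; rewrite addnS /= IHj ?(ltnW jL) // -natr1.
have -> : (p < (p + j).+1 <= p + L)%N by lia.
by move=> /(_ isT); lra.
Qed.

Lemma hair_no_zigzag (R : realType) (T : finType) (e : rel T) (X : T -> R)
    (k : nat) (w : nat -> T) (p q : nat) :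
  symmetric e -> edge_optimal e X -> hair e k w ->
  (0 < p)%N -> (p < q < k)%N ->
  X (w p) - X (w p.-1) = 1 ->
  (forall i, (p < i <= q)%N -> X (w i) - X (w i.-1) = -1) ->
  X (w q.+1) - X (w q) = 1 -> False.
Proof.
move=> e_sym X_opt w_hair p0 /andP[pq qk] dp dpq dq.
have kT := hair_card w_hair.
pose N : R := #|T|%:R; have N0 : 0 < N by rewrite ltr0n; lia.
pose L := (q - p)%N; pose c := (k - q)%N.
have Lr0 : 0 < L%:R :> R by rewrite ltr0n /L; lia.
have cr0 : 0 < c%:R :> R by rewrite ltr0n /c; lia.
pose h := X (w p) - mean X.
have y j : (j <= L)%N -> X (w (p + j)%N) - mean X = h - j%:R.
  move=> jL; rewrite (@descent _ (fun i => X (w i)) p L) // /h; first by lra.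
  by move=> i ?; apply: dpq; rewrite /L in jL *; lia.
have yq : X (w q) - mean X = h - L%:R.
  by rewrite -y // /L subnKC // ltnW.
(* The steps after [q.+1] are not prescribed; an upper bound suffices, because [hC] bounds the sum
   over the tail from below. *)
have ytail j : (q + j <= k)%N -> X (w (q + j)%N) - mean X <= h - L%:R + j%:R.
  elim: j => [|j IHj] jk; first by rewrite addn0 yq addr0.
  have ik : (1 <= q + j.+1 <= k)%N by lia.
  have := X_opt.1 _ _ (hair_edge w_hair ik).
  rewrite ler_norml addnS /= -natr1.
  by have := IHj ltac:(lia); lra.
have hA : h <= (L%:R - 1) / 2 + L%:R / N.
  have := @hair_shift_up _ _ _ _ _ _ p.+1 L e_sym X_opt w_hair isT.
  have eq : (p.+1 + L = q.+1)%N by rewrite /L; lia.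
  rewrite eq /= => /(_ ltac:(rewrite /L; lia) ltac:(lia)).
  move=> /(_ (dpq p.+1 ltac:(lia)) (fun _ => dq)).
  under eq_bigr => i _ do
    (rewrite addSnnS y ?ltn_ord // -natr1;
     rewrite (_ : _ - _ = (h - 1) + (-1) * i%:R); last by ring).
  rewrite sum_arith -mulrN ler_pM2l // -/N; lra.
have hB : (L%:R + 1) / 2 - L%:R / N <= h.
  have := @hair_shift_down _ _ _ _ _ _ p L e_sym X_opt w_hair p0.
  have eq : (p + L = q)%N by rewrite /L; lia.
  rewrite eq /= => /(_ ltac:(rewrite /L; lia) ltac:(lia) dp).
  move=> /(_ (fun _ => dpq q ltac:(lia))).
  under eq_bigr => i _ do
    (rewrite y ?(ltnW (ltn_ord i)) // -mulN1r).
  rewrite sum_arith ler_pM2l // -/N; lra.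
have hC : 2 - 2 * c%:R / N <= 2 * h - 2 * L%:R + c%:R + 1.
  have := @hair_shift_down _ _ _ _ _ _ q.+1 c e_sym X_opt w_hair isT.
  have eq : (q.+1 + c = k.+1)%N by rewrite /c; lia.
  rewrite eq /= => /(_ ltac:(rewrite /c; lia) ltac:(lia) dq).
  move=> /(_ ltac:(lia)) hC.
  have : \sum_(i < c) (X (w (q.+1 + i)%N) - mean X) <=
      \sum_(i < c) (h - L%:R + 1 + 1 * i%:R).
    apply: ler_sum => i _; rewrite addSnnS.
    have := ytail i.+1; rewrite -natr1 => hi.
    by apply: le_trans (hi _) _; [have := ltn_ord i; rewrite /c; lia | lra].
  rewrite sum_arith => /(le_trans hC); rewrite ler_pM2l // -/N; lra.
(* [hA] and [hB] together give [1 <= 2 * L / N]. *)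
have n2L : (#|T| <= 2 * L)%N.
  rewrite -(ler_nat R) -/N natrM -(@ler_pM2r _ N^-1) ?invr_gt0 //.
  by rewrite divff ?gt_eqF //; lra.
(* Inserting [hA] into [hC] gives [2 - 2 * (L + c) / N <= c - L], and the left side is positive
   since [L + c = k - p < #|T|]. *)
have cL : (L < c)%N.
  rewrite -(ltr_nat R).
  have : (L%:R + c%:R) / N < 1.
    by rewrite ltr_pdivrMr // mul1r -natrD ltr_nat /L /c; lia.
  by rewrite mulrDl; lra.
by rewrite /L /c in n2L cL; lia.
Qed.

(** * Monotonicity: counting values outside the hair, and exclusion of a peak *)

(** A discrete intermediate value theorem: if no value lies in [[c, c + 1)], then no edge leaves the
    set where [Z < c], which by connectedness would contain [v]. *)
Lemma edge_lipschitz_ivt (R : realType) (T : finType) (e : rel T) (Z : T -> R)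
    (u v : T) (c : R) :
  symmetric e -> connected_graph e -> edge_lipschitz e Z ->
  Z u <= c <= Z v -> exists x, c <= Z x < c + 1.
Proof.
move=> e_sym e_conn LZ /andP[uc cv].
have [/existsP//|/existsPn gap] := boolP [exists x, c <= Z x < c + 1].
have Zlt x : Z x < c + 1 -> Z x < c.
  by move=> lt1; have := gap x; rewrite lt1 andbT -ltNge.
have a_closed : closed e [pred x | Z x < c].
  apply: intro_closed; first exact: sym_connect_sym.
  move=> x y exy; rewrite !inE => xc; apply: Zlt.
  by have := LZ _ _ exy; rewrite ler_norml; lra.
have uc' : Z u < c by apply: Zlt; lra.
have := closed_connect a_closed (e_conn u v); rewrite !inE uc'.
by rewrite ltNge cv.
Qed.

(* Collapsing the hair onto [w 0] keeps [X] edge-Lipschitz, so the values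
   outside the hair have no gap of length 1. *)
Lemma hair_outside_card (R : realType) (T : finType) (e : rel T) (X : T -> R)
    (k : nat) (w : nat -> T) (u v : T) (r : nat) :
  symmetric e -> connected_graph e -> edge_lipschitz e X -> hair e k w ->
  (forall i, (1 <= i <= k)%N -> u <> w i) ->
  (forall i, (1 <= i <= k)%N -> v <> w i) ->
  X u + r%:R <= X v -> (k + r < #|T|)%N.
Proof.
move=> e_sym e_conn LX w_hair u_out v_out uv.
have [w_inj _ _] := w_hair.
pose H := [set w i.+1 | i : 'I_k].
have memH j : (1 <= j <= k)%N -> w j \in H.
  case: j => // j /= jk; apply/imsetP; by exists (Ordinal jk).
have outH x : (forall i, (1 <= i <= k)%N -> x <> w i) -> x \notin H.
  move=> x_out; apply/negP => /imsetP[i _]; apply: x_out; exact: ltn_ord.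
have cH : #|H| = k.
  rewrite card_imset ?card_ord // => i j /w_inj eij.
  by apply/val_inj/succn_inj/eij; rewrite inE ltn_ord.
have w0H : w 0%N \notin H.
  apply: outH => i ik /w_inj; rewrite !inE => /(_ isT ltac:(lia)); lia.
have bdry x y : e x y -> x \in H -> y \notin H -> y = w 0%N.
  move=> + /imsetP[i _ ex] yH; rewrite {}ex => exy.
  have ik := ltn_ord i.
  have [ey|[lt_k ey]] := hair_neighbour w_hair (ik : (1 <= i.+1 <= k)%N) exy.
    have [i0|i0] := eqVneq (nat_of_ord i) 0%N; first by rewrite ey i0.
    by move: yH; rewrite ey memH //=; lia.
  by rewrite ey memH in yH.
pose Z x := if x \in H then X (w 0%N) else X x.
have LZ : edge_lipschitz e Z.
  move=> x y exy; rewrite /Z; case: ifPn => xH; case: ifPn => yH.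
  - by rewrite subrr normr0.
  - by rewrite (bdry _ _ exy) // subrr normr0.
  - by rewrite (bdry y x) ?subrr ?normr0 // e_sym.
  - exact: LX.
(* These [r.+1] unit intervals are disjoint, so they yield distinct vertices. A value that [Z] takes
   on [H] is that of [w 0], which lies outside [H]. *)
have val (i : 'I_r.+1) :
    exists x, x \notin H /\ X u + i%:R <= X x < X u + i%:R + 1.
  have ir : i%:R <= r%:R :> R by rewrite ler_nat -ltnS.
  have i0 : 0 <= i%:R :> R by [].
  have [|x] := @edge_lipschitz_ivt _ _ _ Z u v (X u + i%:R) e_sym e_conn LZ.
    by rewrite /Z !ifN ?outH //; lra.
  rewrite /Z; case: ifPn => xH xc; first by exists (w 0%N).
  by exists x.
have [f fP] := fin_all_exists val.
have f_le i j : f i = f j -> (i <= j)%N.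
  move=> eij; rewrite -ltnS -(ltr_nat R) -natr1.
  by have [_] := fP i; have [_] := fP j; rewrite eij; lra.
have f_inj : injective f.
  by move=> i j eij; apply/val_inj/eqP; rewrite eqn_leq !f_le.
have fH : f @: 'I_r.+1 \subset ~: H.
  by apply/fintype.subsetP => _ /imsetP[i _ ->]; rewrite inE; case: (fP i).
have := subset_leq_card fH; rewrite card_imset // card_ord -(cardsC H) cH.
by rewrite ltn_add2l.
Qed.

Lemma hair_no_peak (R : realType) (T : finType) (e : rel T) (X : T -> R)
    (k : nat) (w : nat -> T) (l : nat) (u v : T) :
  symmetric e -> connected_graph e -> edge_optimal e X -> hair e k w ->
  (0 < l < k)%N -> X (w l) - X (w l.-1) = 1 ->
  (forall i, (l < i <= k)%N -> X (w i) - X (w i.-1) = -1) ->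
  (forall i, (1 <= i <= k)%N -> u <> w i) ->
  (forall i, (1 <= i <= k)%N -> v <> w i) ->
  X u <= X (w k) + 1 -> X (w l) - 1 <= X v -> False.
Proof.
move=> e_sym e_conn X_opt w_hair /andP[l0 lk] dl dlk u_out v_out uk vl.
have kT := hair_card w_hair.
pose N : R := #|T|%:R; have N0 : 0 < N by rewrite ltr0n; lia.
pose r := (k - l)%N; have lrk : (l + r = k)%N by rewrite /r; lia.
have rr0 : 0 < r%:R :> R by rewrite ltr0n; lia.
pose h := X (w l) - mean X.
have x j : (j <= r)%N -> X (w (l + j)%N) = X (w l) - j%:R.
  move=> jr; rewrite (@descent _ (fun i => X (w i)) l r) //.
  by move=> i ?; apply: dlk; lia.
have hA : h <= (r%:R - 1) / 2 + r%:R / N.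
  have := @hair_shift_up _ _ _ _ _ _ l.+1 r e_sym X_opt w_hair isT.
  move=> /(_ ltac:(lia) ltac:(lia) (dlk l.+1 ltac:(lia)) ltac:(lia)).
  under eq_bigr => i _ do
    (rewrite addSnnS x ?ltn_ord // -natr1;
     rewrite (_ : _ - _ = (h - 1) + (-1) * i%:R); last by rewrite /h; ring).
  rewrite sum_arith -mulrN ler_pM2l // -/N; lra.
have hB : r%:R / 2 + 1 - (r%:R + 1) / N <= h.
  have := @hair_shift_down _ _ _ _ _ _ l r.+1 e_sym X_opt w_hair l0.
  move=> /(_ ltac:(lia) ltac:(lia) dl ltac:(lia)).
  under eq_bigr => i _ do
    (rewrite x; last (by rewrite -ltnS ltn_ord);
     rewrite (_ : _ - _ = h + (-1) * i%:R); last by rewrite /h; ring).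
  rewrite sum_arith ler_pM2l ?ltr0n // -natr1 -/N; lra.
(* [hA] and [hB] give [3 / 2 <= (2 * r + 1) / N]. *)
have n4r : (3 * #|T| <= 4 * r + 2)%N.
  rewrite -(ler_nat R) natrD !natrM -/N -(@ler_pM2r _ N^-1) ?invr_gt0 //.
  by rewrite mulfK ?gt_eqF //; lra.
(* The truncated subtraction is exact: [n4r] and [r + 2 <= #|T|] force [4 <= r]. *)
have rE : (r - 2)%:R = r%:R - 2 :> R by rewrite natrB //; lia.
have := @hair_outside_card _ _ _ X k w u v (r - 2)%N e_sym e_conn X_opt.1 w_hair
  u_out v_out.
have xk : X (w k) = X (w l) - r%:R by rewrite -x // lrk.
by rewrite rE => /(_ ltac:(lra)); lia.
Qed.

(** * Runs of equal steps and the conclusion *)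

(** Isolates the final constant run. Applied first up to [k] and then up to the [l] so found, it
    exhibits two changes of direction whenever there is more than one. *)
Lemma last_change (b : nat -> bool) (k : nat) :
  (forall i, (1 <= i <= k)%N -> b i = b k) \/
  exists l, [/\ (0 < l < k)%N, b l = ~~ b k &
    forall i, (l < i <= k)%N -> b i = b k].
Proof.
elim: k => [|k IHk]; first by left=> i; lia.
have ext l : b k.+1 = b k -> (forall i, (l < i <= k)%N -> b i = b k) ->
    forall i, (l < i <= k.+1)%N -> b i = b k.+1.
  move=> bk bl i /andP[li]; rewrite leq_eqVlt => /orP[/eqP->//|ik].
  by rewrite bk bl // li.
have [k0|k0] := posnP k; first by left=> i ik; congr b; lia.
have [bk|bk] := eqVneq (b k.+1) (b k).
  have [bc|[l [lk bl bc]]] := IHk; first by left; apply: ext.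
  by right; exists l; split; [lia | rewrite bk | apply: ext].
right; exists k; split; first by lia.
  by case: (b k) (b k.+1) bk => [] [].
by move=> i ik; congr b; lia.
Qed.

Theorem lemma2p10 (R : realType) (T : finType) (e : rel T)
    (e_sym : symmetric e) (e_irr : irreflexive e) (e_conn : connected_graph e)
    (X : T -> R) (X_opt : variance_optimal e X)
    (k : nat) (k_ge1 : (1 <= k)%N) (w : nat -> T) (w_hair : hair e k w) :
  let m := \big[Num.min/X (w 0%N)]_(i < k.+1) X (w i) in
  let M := \big[Num.max/X (w 0%N)]_(i < k.+1) X (w i) in
  unimodular k (fun i => X (w i)) /\
  ((exists u' u'' : T,
      [/\ X u' <= m + 1, X u'' >= M - 1,
          forall i, (1 <= i <= k)%N -> u' <> w i
        & forall i, (1 <= i <= k)%N -> u'' <> w i]) ->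
   monotone_seq k (fun i => X (w i))).
Proof.
move=> m M.
have X_eopt : edge_optimal e X.
  have [LX X_max] := (variance_optimalP _ _).1 X_opt.
  split=> [|Y LY]; first exact/glipschitzP.
  exact/X_max/glipschitzP.
have NX_eopt := edge_optimalN X_eopt.
(* By [hair_step], this Boolean determines each step: 1 if true, -1 if false. *)
pose b i := X (w i) - X (w i.-1) == 1.
have bE i : (1 <= i <= k)%N -> X (w i) - X (w i.-1) = if b i then 1 else -1.
  by rewrite /b => /(hair_step e_sym X_eopt w_hair); case: eqP => // ? [].
have const_step j : (forall i, (1 <= i <= j)%N -> b i = b j) -> (j <= k)%N ->
    forall i i', (1 <= i <= j)%N -> (1 <= i' <= j)%N ->
    X (w i) - X (w i.-1) = X (w i') - X (w i'.-1).
  by move=> bj jk i i' ij ij'; rewrite !bE ?bj //; lia.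
split.
  have [bk|[l [lk bl bk]]] := last_change b k.
    exists k; split=> //; first exact: const_step.
    by move=> j j'; lia.
  have [bl'|[p [pl bp bpl]]] := last_change b l.
    exists l; split; first by lia.
      by apply: const_step => //; lia.
    by move=> j j' jk jk'; rewrite !bE ?bk //; lia.
  (* If the middle run rises, the pattern is -1, 1, -1 and the zigzag occurs in [-X]. *)
  exfalso; case bl0 : (b l) in bl bp bpl.
    apply: (@hair_no_zigzag _ _ _ _ _ _ p l e_sym NX_eopt w_hair); try lia.
    - by have := bE p ltac:(lia); rewrite bp /=; lra.
    - by move=> i ipl; have := bE i ltac:(lia); rewrite bpl //; lra.
    - have := bE l.+1 ltac:(lia); rewrite bk; last by lia.
      by rewrite -[b k]negbK -bl /=; lra.
  apply: (@hair_no_zigzag _ _ _ _ _ _ p l e_sym X_eopt w_hair); try lia.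
  - by rewrite bE ?bp //; lia.
  - by move=> i ipl; rewrite bE ?bpl //; lia.
  - rewrite (bE l.+1) ?bk; try lia.
    by rewrite -[b k]negbK -bl.
case=> u [v [um vM u_out v_out]].
have mle i : (i <= k)%N -> m <= X (w i).
  rewrite -ltnS => ik.
  exact: (@bigmin_le _ _ _ _ (Ordinal ik) (fun i : 'I_k.+1 => X (w i))).
have Mge i : (i <= k)%N -> X (w i) <= M.
  rewrite -ltnS => ik.
  exact: (@le_bigmax _ _ _ _ (fun i : 'I_k.+1 => X (w i)) (Ordinal ik)).
have [bk|[l [lk bl bk]]] := last_change b k.
  case bk0 : (b k) in bk; [left|right] => i j /andP[/subnKC <-];
    elim: (j - i)%N => [|d IHd] dk; rewrite ?addn0 // addnS in dk *;
    have := bE (i + d).+1 ltac:(lia); have := IHd ltac:(lia);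
    rewrite bk /=; by [lra | lia].
have lk' : (l <= k)%N by lia.
(* If the last run rises, [w l] is a valley. Passing to [-X] makes it a peak and exchanges the roles
   of [u] and [v]. *)
exfalso; case bk0 : (b k) in bl bk.
  apply: (@hair_no_peak _ _ _ _ _ _ l v u e_sym e_conn NX_eopt w_hair) => //.
  - by have := bE l ltac:(lia); rewrite bl /=; lra.
  - by move=> i ilk; have := bE i ltac:(lia); rewrite bk //; lra.
  - by have := Mge k (leqnn k); lra.
  - by have := mle l lk'; lra.
apply: (@hair_no_peak _ _ _ _ _ _ l u v e_sym e_conn X_eopt w_hair) => //.
- by rewrite bE ?bl //; lia.
- by move=> i ilk; rewrite bE ?bk //; lia.
- by have := mle k (leqnn k); lra.
- by have := Mge l lk'; lra.
Qed.
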